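(* Let $\alpha_7,\beta_7,\alpha_8,\beta_8$ be real numbers. The double inequalities $$Q^{\alpha_{7}}(a,b)\,A^{1-\alpha_{7}}(a,b)<N_{QA}(a,b)<Q^{\beta_{7}}(a,b)\,A^{1-\beta_{7}}(a,b),$$ $$\frac{\alpha_{8}}{A(a,b)}+\frac{1-\alpha_{8}}{Q(a,b)}<\frac{1}{N_{QA}(a,b)}<\frac{\beta_{8}}{A(a,b)}+\frac{1-\beta_{8}}{Q(a,b)}$$ hold for all $a,b>0$ with $a\neq b$ if and only if $\alpha_{7}\leq 1/3$, $\beta_{7}\geq \dfrac{2\log[\sqrt{2}+\log(1+\sqrt{2})]}{\log 2}-2=0.3977\ldots$, $\alpha_{8}\leq \dfrac{2+\sqrt{2}-(1+\sqrt{2})\log(1+\sqrt{2})}{\sqrt{2}+\log(1+\sqrt{2})}=0.5603\ldots$ and $\beta_{8}\geq 2/3$.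
   Context: For $a,b>0$, $A(a,b)=(a+b)/2$ and $Q(a,b)=\sqrt{(a^{2}+b^{2})/2}$ are the arithmetic and quadratic means; $Q^{p}(a,b)$ means $(Q(a,b))^{p}$, and similarly for $A$. For $a,b>0$ with $a\ne b$, the Schwab-Borchardt mean is $$SB(a,b)=\begin{cases}\dfrac{\sqrt{b^2-a^2}}{\cos^{-1}(a/b)}, & a<b,\\[2mm] \dfrac{\sqrt{a^2-b^2}}{\cosh^{-1}(a/b)}, & a>b,\end{cases}$$ where $\cos^{-1}$ is the inverse cosine and $\cosh^{-1}(x)=\log(x+\sqrt{x^2-1})$ is the inverse hyperbolic cosine. The Neuman mean is $N(a,b)=\frac12\left(a+\frac{b^{2}}{SB(a,b)}\right)$, and $N_{QA}(a,b)=N(Q(a,b),A(a,b))$ for $a\neq b$. Here $\log$ is the natural logarithm. *)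

(* Defs.v *)
From Stdlib Require Import Reals.
Open Scope R_scope.

Definition arith_mean (a b : R) : R := (a + b) / 2.

Definition quad_mean (a b : R) : R := sqrt ((a ^ 2 + b ^ 2) / 2).

Definition arcosh (x : R) : R := ln (x + sqrt (x ^ 2 - 1)).

(* The Schwab-Borchardt mean is only meant for [0 < a], [0 < b], [a <> b];
   the value that the [else] branch gives at [a = b] has no significance. *)
Definition SB (a b : R) : R :=
  if Rlt_dec a b
  then sqrt (b ^ 2 - a ^ 2) / acos (a / b)
  else sqrt (a ^ 2 - b ^ 2) / arcosh (a / b).

Definition neuman_mean (a b : R) : R := (a + b ^ 2 / SB a b) / 2.

Definition N_QA (a b : R) : R := neuman_mean (quad_mean a b) (arith_mean a b).

Definition beta7_bound : R :=
  2 * ln (sqrt 2 + ln (1 + sqrt 2)) / ln 2 - 2.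

Definition alpha8_bound : R :=
  (2 + sqrt 2 - (1 + sqrt 2) * ln (1 + sqrt 2)) / (sqrt 2 + ln (1 + sqrt 2)).

(* Main.v *)
Require Import Defs.
From Stdlib Require Import Reals Lra Lia.
From Coquelicot Require Import Coquelicot.
Open Scope R_scope.

(** Writing [Q = A cosh t], so that [sinh t = |a - b| / (a + b)], makes
    everything homogeneous: [t] ranges over the interval from [0] to
    [T = ln (1 + sqrt 2)], both ends excluded, and [N_QA = A nu(t)] with
    [nu(t) = (cosh t + t / sinh t) / 2].  The two double inequalities become
    sign conditions on

      - [geo_gap b t = b ln (cosh t) - ln (nu t)], increasing in [b], and
      - [harm_gap l t = 1 / nu t - (l + (1 - l) / cosh t)], decreasing in [l].

    Both gaps tend to [0] at [t = 0].  The constants [beta7_bound] and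
    [alpha8_bound] are exactly those for which the gap vanishes at [T] as
    well, while [1/3] and [2/3] are those for which the leading coefficient
    at [0] vanishes.

    The sign of each gap is reduced to that of a polynomial.  The inequality
    [0 < harm_gap l t] can be solved for the only occurrence of [t] outside
    the hyperbolic functions, and so can [0 < (geo_gap b)' t]; they read
    [t < R(t)] and [R(t) < t] for functions [R] that are rational in [cosh t]
    and [sinh t].  The derivative of the difference of the two sides
    ([harm_core], [geo_core]) no longer contains [t], and up to a positive
    factor it is a polynomial in [cosh t - 1] or in [sinh t ^ 2].  In the
    relevant range of the parameter this polynomial is strictly decreasing.

    A strictly decreasing function that reaches a nonpositive value stays negative
    afterwards, and this property [descends] passes from a derivative to a
    function vanishing at [0] ([descends_of_derive]).  Hence a gap that
    vanishes at [T] is positive before [T], which gives sufficiency of the two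
    transcendental constants.  The constant term of the polynomial decides
    what happens near [0].  When it is zero (parameters [1/3], [2/3]) the
    polynomial, and so the gap, is negative everywhere; when it is positive
    the gap is positive near [0], which rules out any parameter on the wrong
    side of [1/3] or [2/3].  Necessity of the other two constants follows from
    continuity of the gaps at [T]. *)

(** * Signs of functions that start at zero *)

Definition vanishes_at_0 (f : R -> R) : Prop :=
  filterlim f (at_right 0) (locally 0).

Definition pos_near_0 (f : R -> R) : Prop := at_right 0 (fun t => 0 < f t).

(** Once a function with this property is nonpositive, it is negative from
    then on: at most one change of sign, from positive to negative. *)
Definition descends (f : R -> R) : Prop :=
  forall x y, 0 < x < y -> f x <= 0 -> f y < 0.

Lemma at_right_0_interval (b : R) : 0 < b -> at_right 0 (fun t => 0 < t < b).
Proof.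
  intros Hb. exists (mkposreal b Hb). intros t Hball Ht. split; [exact Ht |].
  change (Rabs (t - 0) < b) in Hball. apply Rabs_def2 in Hball. lra.
Qed.

Lemma vanishes_at_0_continuous (f : R -> R) :
  continuous f 0 -> f 0 = 0 -> vanishes_at_0 f.
Proof.
  intros Hf H0 P HP. apply filter_le_within. apply (Hf P). rewrite H0. exact HP.
Qed.

Lemma vanishes_at_0_opp (f : R -> R) :
  vanishes_at_0 f -> vanishes_at_0 (fun t => - f t).
Proof.
  intros Hf. apply (filterlim_comp _ _ _ f Ropp _ _ _ Hf).
  pose proof (filterlim_Rbar_opp 0) as H. simpl in H.
  rewrite Ropp_0 in H. exact H.
Qed.

Lemma vanishes_at_0_squeeze (f g : R -> R) :
  (forall t, 0 < t -> - g t <= f t <= g t) ->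
  vanishes_at_0 g -> vanishes_at_0 f.
Proof.
  intros Hfg Hg. apply (filterlim_le_le (fun t => - g t) f g (Finite 0)).
  - apply (filter_imp (fun t => 0 < t < 1)); [intros t Ht; apply Hfg, Ht |].
    apply at_right_0_interval. lra.
  - apply vanishes_at_0_opp, Hg.
  - exact Hg.
Qed.

Lemma pos_near_0_continuous (f : R -> R) :
  continuous f 0 -> 0 < f 0 -> pos_near_0 f.
Proof.
  intros Hf H0. apply filter_le_within.
  apply (Hf (fun y => 0 < y)). apply (open_gt 0), H0.
Qed.

Lemma nonneg_at_right_end (f : R -> R) (b : R) :
  0 < b -> continuous f b -> (forall t, 0 < t < b -> 0 < f t) -> 0 <= f b.
Proof.
  intros Hb Hf Hpos.
  apply (filterlim_le (F := at_left b) (fun _ => 0) f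
           (Finite 0) (Finite (f b))).
  - exists (mkposreal b Hb). intros t Hball Ht. left. apply Hpos.
    change (Rabs (t - b) < b) in Hball. apply Rabs_def2 in Hball. lra.
  - apply filterlim_const.
  - intros P HP. apply filter_le_within, (Hf P HP).
Qed.

Lemma increasing_of_derive (f df : R -> R) (a b : R) :
  a < b -> (forall t, a <= t <= b -> is_derive f t (df t)) ->
  (forall t, a < t < b -> 0 < df t) -> f a < f b.
Proof.
  intros Hab Hd Hpos.
  destruct (MVT_cor2 f df a b Hab) as (c & Heq & Hc).
  - intros c Hc. apply is_derive_Reals, Hd, Hc.
  - specialize (Hpos c Hc). nra.
Qed.

(** Monotonicity argument started at the open end [0], where [f] is known only
    through its limit (the gap of logarithms involves [t / sinh t]). *)
Lemma pos_of_derive_pos (f df : R -> R) (x : R) :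
  0 < x -> vanishes_at_0 f -> (forall t, 0 < t -> is_derive f t (df t)) ->
  (forall t, 0 < t < x -> 0 < df t) -> 0 < f x.
Proof.
  intros Hx H0 Hd Hpos.
  assert (Hmono : forall s t, 0 < s < t -> t <= x -> f s < f t).
  { intros s t Hst Htx. apply (increasing_of_derive f df); [lra | |].
    - intros u Hu. apply Hd. lra.
    - intros u Hu. apply Hpos. lra. }
  assert (Hhalf : 0 <= f (x / 2)).
  { apply (filterlim_le (F := at_right 0) f (fun _ => f (x / 2))
             (Finite 0) (Finite (f (x / 2))));
      [| exact H0 | apply filterlim_const].
    apply (filter_imp (fun t => 0 < t < x / 2)).
    - intros t Ht. left. apply Hmono; lra.
    - apply at_right_0_interval. lra. }
  specialize (Hmono (x / 2) x). lra.
Qed.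

Lemma descends_mult (f g w : R -> R) :
  (forall t, 0 < t -> 0 < w t) -> (forall t, 0 < t -> f t = g t * w t) ->
  descends g -> descends f.
Proof.
  intros Hw Hf Hg x y Hxy. rewrite !Hf by lra.
  pose proof (Hw x ltac:(lra)). pose proof (Hw y ltac:(lra)).
  specialize (Hg x y Hxy). intros Hx.
  assert (g x <= 0) by nra. assert (g y < 0) by auto. nra.
Qed.

Lemma pos_near_0_mult (f g w : R -> R) :
  (forall t, 0 < t -> 0 < w t) -> (forall t, 0 < t -> f t = g t * w t) ->
  pos_near_0 g -> pos_near_0 f.
Proof.
  intros Hw Hf Hg. unfold pos_near_0.
  apply (filter_imp (fun t => 0 < g t /\ 0 < t < 1)).
  - intros t Ht. rewrite Hf by lra. apply Rmult_lt_0_compat; [lra |].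
    apply Hw. lra.
  - apply filter_and; [exact Hg |]. apply at_right_0_interval. lra.
Qed.

(** Here and in the next two lemmas the derivative comes as a product, so that
    a positive factor [w] can be split off and the sign read from a simpler
    function [g]. *)
Lemma neg_of_derive_neg (f g w : R -> R) :
  vanishes_at_0 f -> (forall t, 0 < t -> 0 < w t) ->
  (forall t, 0 < t -> is_derive f t (g t * w t)) ->
  (forall t, 0 < t -> g t < 0) -> forall t, 0 < t -> f t < 0.
Proof.
  intros H0 Hw Hd Hneg t Ht. enough (0 < - f t) by lra.
  apply (pos_of_derive_pos (fun t => - f t) (fun t => - (g t * w t)));
    [exact Ht | apply vanishes_at_0_opp, H0 | |].
  - intros u Hu. apply (is_derive_opp f u (g u * w u)), Hd, Hu.
  - intros u Hu. specialize (Hneg u (proj1 Hu)). specialize (Hw u (proj1 Hu)).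
    nra.
Qed.

Lemma pos_near_0_of_derive (f g w : R -> R) :
  vanishes_at_0 f -> (forall t, 0 < t -> 0 < w t) ->
  (forall t, 0 < t -> is_derive f t (g t * w t)) ->
  pos_near_0 g -> pos_near_0 f.
Proof.
  intros H0 Hw Hd Hg.
  destruct (pos_near_0_mult _ g w Hw (fun t _ => eq_refl) Hg) as [d Hpos].
  exists d. intros x Hball Hx.
  change (Rabs (x - 0) < d) in Hball. apply Rabs_def2 in Hball.
  apply (pos_of_derive_pos f _ x Hx H0 Hd).
  intros t Ht. apply Hpos; [| lra].
  change (Rabs (t - 0) < d). apply Rabs_def1; lra.
Qed.

(** If [f x <= 0] although [f] starts from [0], then [g] cannot be positive
    all the way up to [x]; so [g] has become negative by [x], and [f]
    decreases strictly from there on. *)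
Lemma descends_of_derive (f g w : R -> R) :
  vanishes_at_0 f -> (forall t, 0 < t -> 0 < w t) ->
  (forall t, 0 < t -> is_derive f t (g t * w t)) ->
  descends g -> descends f.
Proof.
  intros H0 Hw Hd Hg x y Hxy Hfx.
  pose proof (descends_mult _ g w Hw (fun t _ => eq_refl) Hg) as Hdesc.
  assert (Hneg : forall t, x < t -> g t * w t < 0).
  { intros t Ht.
    destruct (Rlt_or_le (g t * w t) 0) as [H | H]; [exact H | exfalso].
    enough (0 < f x) by lra.
    apply (pos_of_derive_pos f _ x (proj1 Hxy) H0 Hd).
    intros s Hs.
    destruct (Rlt_or_le 0 (g s * w s)) as [Hs' | Hs']; [exact Hs' |].
    specialize (Hdesc s t). lra. }
  enough (- f x < - f y) by lra.
  apply (increasing_of_derive (fun t => - f t) (fun t => - (g t * w t)));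
    [lra | |].
  - intros t Ht. apply (is_derive_opp f t (g t * w t)), Hd. lra.
  - intros t Ht. specialize (Hneg t). lra.
Qed.

Lemma descends_of_decreasing (f : R -> R) :
  (forall x y, 0 < x < y -> f y < f x) -> descends f.
Proof. intros H x y Hxy Hx. specialize (H x y Hxy). lra. Qed.

Lemma pos_before_zero (f : R -> R) (b t : R) :
  descends f -> f b = 0 -> 0 < t < b -> 0 < f t.
Proof.
  intros Hf Hb Ht. destruct (Rlt_or_le 0 (f t)) as [H | H]; [exact H |].
  specialize (Hf t b Ht H). lra.
Qed.

(** * Hyperbolic functions *)

Lemma cosh_sinh_sqr (t : R) : cosh t ^ 2 = 1 + sinh t ^ 2.
Proof.
  unfold cosh, sinh. assert (H : exp t * exp (- t) = 1).
  { rewrite <- exp_plus, Rplus_opp_r. apply exp_0. }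
  nra.
Qed.

Lemma sinh_increasing (x y : R) : x < y -> sinh x < sinh y.
Proof.
  intros H. unfold sinh. pose proof (exp_increasing x y H).
  pose proof (exp_increasing (- y) (- x) ltac:(lra)). lra.
Qed.

Lemma sinh_pos (t : R) : 0 < t -> 0 < sinh t.
Proof. intros H. rewrite <- sinh_0. apply sinh_increasing, H. Qed.

Lemma cosh_pos (t : R) : 0 < cosh t.
Proof.
  unfold cosh. pose proof (exp_pos t). pose proof (exp_pos (- t)). lra.
Qed.

Lemma cosh_increasing (x y : R) : 0 <= x < y -> cosh x < cosh y.
Proof.
  intros H. pose proof (cosh_sinh_sqr x). pose proof (cosh_sinh_sqr y).
  pose proof (cosh_pos x). pose proof (cosh_pos y).
  assert (0 <= sinh x).
  { destruct (proj1 H) as [Hx | Hx]; [left; apply sinh_pos, Hx |].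
    subst x. rewrite sinh_0. lra. }
  pose proof (sinh_increasing x y (proj2 H)). nra.
Qed.

Lemma cosh_gt_1 (t : R) : 0 < t -> 1 < cosh t.
Proof. intros H. rewrite <- cosh_0. apply cosh_increasing. lra. Qed.

Ltac hyperbolic_facts t Ht :=
  pose proof (cosh_sinh_sqr t); pose proof (sinh_pos t Ht);
  pose proof (cosh_gt_1 t Ht).

(** Amounts to [nu t < cosh t]. *)
Lemma lt_cosh_sinh (t : R) : 0 < t -> t < cosh t * sinh t.
Proof.
  intros Ht. enough (0 < cosh t * sinh t - t) by lra.
  apply (pos_of_derive_pos (fun t => cosh t * sinh t - t)
           (fun t => 2 * sinh t ^ 2)); auto.
  - apply vanishes_at_0_continuous.
    + apply (ex_derive_continuous (V := R_NormedModule)). auto_derive. auto.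
    + rewrite sinh_0. lra.
  - intros u Hu. auto_derive; [auto |]. pose proof (cosh_sinh_sqr u). nra.
  - intros u Hu. pose proof (sinh_pos u ltac:(lra)). nra.
Qed.

(** Amounts to [1 < nu t]. *)
Lemma two_sinh_lt (t : R) : 0 < t -> 2 * sinh t < cosh t * sinh t + t.
Proof.
  intros Ht. enough (0 < cosh t * sinh t + t - 2 * sinh t) by lra.
  apply (pos_of_derive_pos (fun t => cosh t * sinh t + t - 2 * sinh t)
           (fun t => 2 * cosh t * (cosh t - 1))); auto.
  - apply vanishes_at_0_continuous.
    + apply (ex_derive_continuous (V := R_NormedModule)). auto_derive. auto.
    + rewrite sinh_0. lra.
  - intros u Hu. auto_derive; [auto |]. pose proof (cosh_sinh_sqr u). nra.
  - intros u Hu. pose proof (cosh_gt_1 u ltac:(lra)). nra.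
Qed.

(** The ratio [N / A] for the Neuman mean [N] of [A cosh t] and [A]. *)
Definition nu (t : R) : R := (cosh t + t / sinh t) / 2.

Lemma nu_eq (t : R) :
  0 < t -> nu t = (cosh t * sinh t + t) / (2 * sinh t).
Proof. intros Ht. hyperbolic_facts t Ht. unfold nu. field. lra. Qed.

Lemma nu_bounds (t : R) : 0 < t -> 1 < nu t < cosh t.
Proof.
  intros Ht. hyperbolic_facts t Ht. pose proof (lt_cosh_sinh t Ht).
  pose proof (two_sinh_lt t Ht). rewrite nu_eq by exact Ht. split.
  - apply Rlt_div_r; lra.
  - apply Rlt_div_l; nra.
Qed.

(** * Comparison with geometric combinations *)

(** Difference of the logarithms of [Q^b A^(1-b) / A] and [N / A]. *)
Definition geo_gap (b t : R) : R := b * ln (cosh t) - ln (nu t).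

(** What the sign of [geo_gap' b t] becomes after solving for the bare [t]:
    the derivative is positive iff
    [cosh t sinh t (cosh^2 t - b sinh^2 t) < t (cosh^2 t + b sinh^2 t)].
    Here [cosh^2 t] is replaced by [1 + sinh^2 t]. *)
Definition geo_core (b t : R) : R :=
  t - cosh t * sinh t * (1 + (1 - b) * sinh t ^ 2) / (1 + (1 + b) * sinh t ^ 2).

(** Numerator of [geo_core' b t] as a polynomial in [z = sinh^2 t], divided by
    [z].  Its constant term is zero exactly at [b = 1/3]. *)
Definition geo_poly (b z : R) : R :=
  (6 * b - 2) + (2 * b ^ 2 + 6 * b - 4) * z - 2 * (1 - b ^ 2) * z ^ 2.

Lemma is_derive_geo_core (b t : R) : 0 <= b -> 0 < t ->
  is_derive (geo_core b) t
    (geo_poly b (sinh t ^ 2) * (sinh t ^ 2 / (1 + (1 + b) * sinh t ^ 2) ^ 2)).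
Proof.
  intros Hb Ht. hyperbolic_facts t Ht.
  assert (0 < 1 + (1 + b) * sinh t ^ 2) by nra.
  unfold geo_core, geo_poly. auto_derive; [lra |].
  field_simplify_eq; [| lra].
  replace (cosh t ^ 2) with (1 + sinh t ^ 2). ring.
Qed.

Lemma is_derive_geo_gap (b t : R) : 0 <= b -> 0 < t ->
  is_derive (geo_gap b) t
    (geo_core b t * ((1 + (1 + b) * sinh t ^ 2)
                     / (cosh t * sinh t * (cosh t * sinh t + t)))).
Proof.
  intros Hb Ht. hyperbolic_facts t Ht. pose proof (nu_bounds t Ht) as Hnu.
  assert (0 < 1 + (1 + b) * sinh t ^ 2) by nra.
  assert (0 < cosh t * sinh t) by nra.
  unfold geo_gap, geo_core. unfold nu in *. auto_derive; [repeat split; lra |].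
  field_simplify_eq; [| repeat split; try lra].
  replace (cosh t ^ 2) with (1 + sinh t ^ 2). ring.
Qed.

Lemma geo_poly_decreasing (b x y : R) :
  1 / 3 <= b <= 1 / 2 -> 0 <= x < y -> geo_poly b y < geo_poly b x.
Proof.
  intros Hb Hxy. unfold geo_poly.
  assert (2 * b ^ 2 + 6 * b - 4 < 0) by nra.
  assert (0 < 1 - b ^ 2) by nra. 
  assert (x ^ 2 < y ^ 2) by nra. nra.
Qed.

Lemma geo_core_vanishes (b : R) : 0 <= b -> vanishes_at_0 (geo_core b).
Proof.
  intros Hb. apply vanishes_at_0_continuous.
  - apply (ex_derive_continuous (V := R_NormedModule)).
    unfold geo_core. auto_derive. rewrite sinh_0. lra.
  - unfold geo_core. rewrite sinh_0. field.
Qed.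

Lemma ln_nu_bounds (t : R) : 0 < t -> 0 < ln (nu t) < ln (cosh t).
Proof.
  intros Ht. pose proof (nu_bounds t Ht). rewrite <- ln_1.
  split; apply ln_increasing; lra.
Qed.

(** For [b] between [0] and [1] both terms of the gap lie between [0] and
    [ln (cosh t)]; this avoids the singular expression [t / sinh t] at [0]. *)
Lemma geo_gap_vanishes (b : R) : 0 <= b <= 1 -> vanishes_at_0 (geo_gap b).
Proof.
  intros Hb. apply (vanishes_at_0_squeeze _ (fun t => ln (cosh t))).
  - intros t Ht. pose proof (ln_nu_bounds t Ht). unfold geo_gap. nra.
  - apply vanishes_at_0_continuous.
    + apply (ex_derive_continuous (V := R_NormedModule)). auto_derive.
      apply cosh_pos.
    + rewrite cosh_0. apply ln_1.
Qed.

Lemma geo_core_weight_pos (b t : R) : 0 <= b -> 0 < t ->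
  0 < sinh t ^ 2 / (1 + (1 + b) * sinh t ^ 2) ^ 2.
Proof.
  intros Hb Ht. pose proof (sinh_pos t Ht).
  apply Rdiv_lt_0_compat; [nra |]. apply pow_lt. nra.
Qed.

Lemma geo_gap_weight_pos (b t : R) : 0 <= b -> 0 < t ->
  0 < (1 + (1 + b) * sinh t ^ 2) / (cosh t * sinh t * (cosh t * sinh t + t)).
Proof.
  intros Hb Ht. hyperbolic_facts t Ht. apply Rdiv_lt_0_compat; [nra |].
  assert (0 < cosh t * sinh t) by nra. nra.
Qed.

Lemma geo_gap_descends (b : R) : 1 / 3 <= b <= 1 / 2 -> descends (geo_gap b).
Proof.
  intros Hb. assert (Hb0 : 0 <= b) by lra.
  apply (descends_of_derive _ _ _ (geo_gap_vanishes b ltac:(lra))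
           (fun t => geo_gap_weight_pos b t Hb0)
           (fun t => is_derive_geo_gap b t Hb0)).
  apply (descends_of_derive _ _ _ (geo_core_vanishes b Hb0)
           (fun t => geo_core_weight_pos b t Hb0)
           (fun t => is_derive_geo_core b t Hb0)).
  apply descends_of_decreasing. intros x y Hxy.
  pose proof (sinh_pos x ltac:(lra)).
  pose proof (sinh_increasing x y ltac:(lra)).
  apply geo_poly_decreasing; nra.
Qed.

Lemma geo_gap_pos_near_0 (b : R) : 1 / 3 < b <= 1 / 2 -> pos_near_0 (geo_gap b).
Proof.
  intros Hb. assert (Hb0 : 0 <= b) by lra.
  apply (pos_near_0_of_derive _ _ _ (geo_gap_vanishes b ltac:(lra))
           (fun t => geo_gap_weight_pos b t Hb0)
           (fun t => is_derive_geo_gap b t Hb0)).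
  apply (pos_near_0_of_derive _ _ _ (geo_core_vanishes b Hb0)
           (fun t => geo_core_weight_pos b t Hb0)
           (fun t => is_derive_geo_core b t Hb0)).
  apply pos_near_0_continuous.
  - apply (ex_derive_continuous (V := R_NormedModule)).
    unfold geo_poly. auto_derive. auto.
  - unfold geo_poly. rewrite sinh_0. lra.
Qed.

Lemma geo_gap_neg (t : R) : 0 < t -> geo_gap (1 / 3) t < 0.
Proof.
  assert (Hb0 : 0 <= 1 / 3) by lra. revert t.
  apply (neg_of_derive_neg _ _ _ (geo_gap_vanishes (1 / 3) ltac:(lra))
           (fun t => geo_gap_weight_pos _ t Hb0)
           (fun t => is_derive_geo_gap _ t Hb0)).
  apply (neg_of_derive_neg _ _ _ (geo_core_vanishes _ Hb0)
           (fun t => geo_core_weight_pos _ t Hb0)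
           (fun t => is_derive_geo_core _ t Hb0)).
  intros t Ht. pose proof (sinh_pos t Ht).
  unfold geo_poly. nra.
Qed.

(** * Comparison with harmonic combinations *)

(** Difference of [A / N] and [A (l / A + (1 - l) / Q)]. *)
Definition harm_gap (l t : R) : R := / nu t - (l + (1 - l) / cosh t).

(** What the sign of [harm_gap l t] becomes after solving for the bare [t]:
    the gap is positive iff
    [t (1 + l (cosh t - 1)) < cosh t sinh t (1 - l (cosh t - 1))]. *)
Definition harm_core (l t : R) : R :=
  cosh t * sinh t * (1 - l * (cosh t - 1)) / (1 + l * (cosh t - 1)) - t.

(** Numerator of [harm_core' l t] as a polynomial in [y = cosh t - 1], divided
    by [y].  Its constant term is zero exactly at [l = 2/3]. *)
Definition harm_poly (l y : R) : R :=
  (4 - 6 * l) + (2 - 6 * l - 2 * l ^ 2) * y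
  - (2 * l + 4 * l ^ 2) * y ^ 2 - 2 * l ^ 2 * y ^ 3.

Lemma harm_poly_decreasing (l x y : R) :
  1 / 3 <= l -> 0 <= x < y -> harm_poly l y < harm_poly l x.
Proof.
  intros Hl Hxy. unfold harm_poly.
  assert (2 - 6 * l - 2 * l ^ 2 < 0) by nra.
  assert (x ^ 2 < y ^ 2) by nra. assert (x ^ 3 < y ^ 3) by nra.
  assert (0 < l ^ 2) by nra. nra.
Qed.

Lemma is_derive_harm_core (l t : R) : 0 <= l -> 0 < t ->
  is_derive (harm_core l) t
    (harm_poly l (cosh t - 1)
     * ((cosh t - 1) / (1 + l * (cosh t - 1)) ^ 2)).
Proof.
  intros Hl Ht. hyperbolic_facts t Ht.
  assert (0 < 1 + l * (cosh t - 1)) by nra.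
  unfold harm_core, harm_poly. auto_derive; [lra |].
  field_simplify_eq; [| lra].
  replace (sinh t ^ 2) with (cosh t ^ 2 - 1) by lra. ring.
Qed.

Lemma harm_core_vanishes (l : R) : vanishes_at_0 (harm_core l).
Proof.
  apply vanishes_at_0_continuous.
  - apply (ex_derive_continuous (V := R_NormedModule)).
    unfold harm_core. auto_derive. rewrite cosh_0. lra.
  - unfold harm_core. rewrite sinh_0, cosh_0. field.
Qed.

Lemma harm_core_weight_pos (l t : R) : 0 <= l -> 0 < t ->
  0 < (cosh t - 1) / (1 + l * (cosh t - 1)) ^ 2.
Proof.
  intros Hl Ht. hyperbolic_facts t Ht.
  apply Rdiv_lt_0_compat; [lra |]. apply pow_lt. nra.
Qed.

Lemma harm_gap_eq (l t : R) : 0 <= l -> 0 < t ->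
  harm_gap l t = harm_core l t
    * ((1 + l * (cosh t - 1)) / (cosh t * (cosh t * sinh t + t))).
Proof.
  intros Hl Ht. hyperbolic_facts t Ht.
  assert (0 < 1 + l * (cosh t - 1)) by nra.
  assert (0 < cosh t * sinh t) by nra.
  unfold harm_gap, harm_core. rewrite nu_eq by exact Ht.
  field. repeat split; lra.
Qed.

Lemma harm_gap_weight_pos (l t : R) : 0 <= l -> 0 < t ->
  0 < (1 + l * (cosh t - 1)) / (cosh t * (cosh t * sinh t + t)).
Proof.
  intros Hl Ht. hyperbolic_facts t Ht. apply Rdiv_lt_0_compat; [nra |].
  assert (0 < cosh t * sinh t) by nra. nra.
Qed.

Lemma harm_gap_descends (l : R) : 1 / 3 <= l -> descends (harm_gap l).
Proof.
  intros Hl. assert (Hl0 : 0 <= l) by lra.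
  apply (descends_mult _ _ _ (fun t => harm_gap_weight_pos l t Hl0)
           (fun t => harm_gap_eq l t Hl0)).
  apply (descends_of_derive _ _ _ (harm_core_vanishes l)
           (fun t => harm_core_weight_pos l t Hl0)
           (fun t => is_derive_harm_core l t Hl0)).
  apply descends_of_decreasing. intros x y Hxy.
  pose proof (cosh_gt_1 x ltac:(lra)).
  pose proof (cosh_increasing x y ltac:(lra)).
  apply harm_poly_decreasing; lra.
Qed.

Lemma harm_gap_pos_near_0 (l : R) : 0 <= l < 2 / 3 -> pos_near_0 (harm_gap l).
Proof.
  intros Hl. assert (Hl0 : 0 <= l) by lra.
  apply (pos_near_0_mult _ _ _ (fun t => harm_gap_weight_pos l t Hl0)
           (fun t => harm_gap_eq l t Hl0)).
  apply (pos_near_0_of_derive _ _ _ (harm_core_vanishes l)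
           (fun t => harm_core_weight_pos l t Hl0)
           (fun t => is_derive_harm_core l t Hl0)).
  apply pos_near_0_continuous.
  - apply (ex_derive_continuous (V := R_NormedModule)).
    unfold harm_poly. auto_derive. auto.
  - unfold harm_poly. rewrite cosh_0. lra.
Qed.

Lemma harm_gap_neg (t : R) : 0 < t -> harm_gap (2 / 3) t < 0.
Proof.
  assert (Hl0 : 0 <= 2 / 3) by lra. intros Ht.
  rewrite harm_gap_eq by assumption.
  pose proof (harm_gap_weight_pos (2 / 3) t Hl0 Ht).
  enough (harm_core (2 / 3) t < 0) by nra. clear H. revert t Ht.
  apply (neg_of_derive_neg _ _ _ (harm_core_vanishes _)
           (fun t => harm_core_weight_pos _ t Hl0)
           (fun t => is_derive_harm_core _ t Hl0)).
  intros t Ht. pose proof (cosh_gt_1 t Ht).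
  pose proof (harm_poly_decreasing (2 / 3) 0 (cosh t - 1)).
  unfold harm_poly in *. lra.
Qed.

(** * The right end of the parameter interval *)

(** The value of [t] in the limit case where one of [a], [b] is [0]:
    [sinh tmax = 1]. *)
Definition tmax : R := ln (1 + sqrt 2).

Lemma sqrt2_sqr : sqrt 2 ^ 2 = 2.
Proof. apply pow2_sqrt. lra. Qed.

Lemma sqrt2_bounds : 1414213 / 1000000 < sqrt 2 < 1414214 / 1000000.
Proof. pose proof sqrt2_sqr. pose proof (sqrt_pos 2). split; nra. Qed.

Lemma sinh_cosh_tmax : sinh tmax = 1 /\ cosh tmax = sqrt 2.
Proof.
  pose proof sqrt2_sqr. pose proof sqrt2_bounds.
  assert (Hexp : exp tmax = 1 + sqrt 2) by (apply exp_ln; lra).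
  assert (Hinv : exp (- tmax) = sqrt 2 - 1).
  { rewrite exp_Ropp, Hexp. field_simplify_eq; [| lra]. lra. }
  unfold sinh, cosh. rewrite Hexp, Hinv. lra.
Qed.

Lemma tmax_pos : 0 < tmax.
Proof.
  unfold tmax. rewrite <- ln_1. apply ln_increasing; [lra |].
  pose proof sqrt2_bounds. lra.
Qed.

Lemma sinh_lt_inv (x y : R) : sinh x < sinh y -> x < y.
Proof.
  intros H. rewrite <- (arcsinh_sinh x), <- (arcsinh_sinh y).
  apply arcsinh_lt, H.
Qed.

Lemma geo_gap_tmax : geo_gap beta7_bound tmax = 0.
Proof.
  pose proof sqrt2_bounds. pose proof tmax_pos.
  assert (Hln2 : 0 < ln 2) by (rewrite <- ln_1; apply ln_increasing; lra).
  unfold geo_gap, nu. destruct sinh_cosh_tmax as [-> ->].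
  assert (Hsqrt : ln (sqrt 2) = ln 2 / 2).
  { rewrite <- sqrt2_sqr at 2. rewrite ln_pow by lra. simpl. field. }
  rewrite Hsqrt. unfold beta7_bound. fold tmax.
  rewrite Rdiv_1_r, ln_div by lra. field. lra.
Qed.

Lemma harm_gap_tmax : harm_gap alpha8_bound tmax = 0.
Proof.
  pose proof sqrt2_bounds. pose proof tmax_pos.
  unfold harm_gap, nu. destruct sinh_cosh_tmax as [-> ->].
  unfold alpha8_bound. fold tmax.
  field_simplify_eq; [| lra].
  replace (sqrt 2 ^ 2) with 2 by (symmetry; apply sqrt2_sqr). ring.
Qed.

Lemma continuous_gaps_tmax (b l : R) :
  continuous (geo_gap b) tmax /\ continuous (harm_gap l) tmax.
Proof.
  pose proof sqrt2_bounds. pose proof tmax_pos.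
  destruct sinh_cosh_tmax as [Hs Hc].
  split; apply (ex_derive_continuous (V := R_NormedModule));
    [unfold geo_gap | unfold harm_gap]; unfold nu; auto_derive;
    rewrite Hs, Hc; repeat split; lra.
Qed.


(** * Numerical values of the constants *)

(** Partial sums of the Taylor series of artanh, which is half the logarithm
    of [(1 + z) / (1 - z)] and converges fast enough for five decimals. *)
Fixpoint artanh_sum (n : nat) (z : R) : R :=
  match n with
  | O => 0
  | S m => artanh_sum m z + z ^ (2 * m + 1) / INR (2 * m + 1)
  end.

Lemma is_derive_odd_monomial (m : nat) (z : R) :
  is_derive (fun z => z ^ (2 * m + 1) / INR (2 * m + 1)) z (z ^ (2 * m)).
Proof.
  replace (z ^ (2 * m)) with (z ^ Nat.pred (2 * m + 1)) by (f_equal; lia).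
  assert (Hk : 0 < INR (2 * m + 1)) by (apply lt_0_INR; lia).
  revert Hk. generalize (2 * m + 1)%nat as k. intros k Hk.
  auto_derive; [auto |]. field. lra.
Qed.

Lemma is_derive_artanh_sum (n : nat) (z : R) : 0 <= z < 1 ->
  is_derive (artanh_sum n) z ((1 - z ^ (2 * n)) / (1 - z ^ 2)).
Proof.
  intros Hz. assert (0 < 1 - z ^ 2) by nra.
  induction n as [| m IH]; cbn [artanh_sum].
  - replace ((1 - z ^ (2 * 0)) / (1 - z ^ 2)) with 0
      by (simpl; field; simpl in *; lra).
    apply (is_derive_const (V := R_NormedModule)).
  - replace ((1 - z ^ (2 * S m)) / (1 - z ^ 2))
      with ((1 - z ^ (2 * m)) / (1 - z ^ 2) + z ^ (2 * m)).
    + apply (is_derive_plus (artanh_sum m)); [exact IH |].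
      apply is_derive_odd_monomial.
    + replace (2 * S m)%nat with (2 + 2 * m)%nat by lia.
      rewrite (pow_add z 2). field. lra.
Qed.

Lemma artanh_sum_0 (n : nat) : artanh_sum n 0 = 0.
Proof.
  induction n as [| m IH]; cbn [artanh_sum]; [reflexivity |].
  rewrite IH, pow_i by lia. lra.
Qed.

Definition half_ln_ratio (z : R) : R := (ln (1 + z) - ln (1 - z)) / 2.

Lemma is_derive_half_ln_ratio (z : R) :
  0 <= z < 1 -> is_derive half_ln_ratio z (/ (1 - z ^ 2)).
Proof.
  intros Hz. assert (0 < 1 - z ^ 2) by nra.
  unfold half_ln_ratio. auto_derive; [lra |]. field. lra.
Qed.

(** Both errors vanish at [0] and are increasing: the derivative of the first
    is [z^(2n) / (1 - z^2)], and the derivative of the proposed remainder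
    exceeds this, because differentiating its numerator gives exactly that
    term and its factor [1 / (1 - z^2)] is increasing. *)
Lemma half_ln_ratio_bounds (n : nat) (z : R) : 0 < z < 1 ->
  artanh_sum n z < half_ln_ratio z
  < artanh_sum n z + z ^ (2 * n + 1) / INR (2 * n + 1) / (1 - z ^ 2).
Proof.
  intros Hz.
  assert (H0 : half_ln_ratio 0 = 0)
    by (unfold half_ln_ratio; rewrite Rplus_0_r, Rminus_0_r; field).
  assert (Hn : 0 < INR (2 * n + 1)) by (apply lt_0_INR; lia).
  split.
  - enough (half_ln_ratio 0 - artanh_sum n 0 < half_ln_ratio z - artanh_sum n z)
      by (rewrite H0, artanh_sum_0 in *; lra).
    apply (increasing_of_derive (fun u => half_ln_ratio u - artanh_sum n u)
             (fun u => / (1 - u ^ 2) - (1 - u ^ (2 * n)) / (1 - u ^ 2)));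
      [lra | |]; intros u Hu.
    + apply (is_derive_minus half_ln_ratio);
        [apply is_derive_half_ln_ratio | apply is_derive_artanh_sum]; lra.
    + assert (0 < / (1 - u ^ 2)) by (apply Rinv_0_lt_compat; nra).
      pose proof (pow_lt u (2 * n) (proj1 Hu)). unfold Rdiv. nra.
  - set (mono := fun u => u ^ (2 * n + 1) / INR (2 * n + 1)).
    enough (artanh_sum n 0 + mono 0 / (1 - 0 ^ 2) - half_ln_ratio 0
            < artanh_sum n z + mono z / (1 - z ^ 2) - half_ln_ratio z).
    { rewrite H0, artanh_sum_0 in H. unfold mono in H at 1.
      rewrite pow_i in H by lia. fold (mono z). lra. }
    apply (increasing_of_derive
             (fun u => artanh_sum n u + mono u / (1 - u ^ 2) - half_ln_ratio u)
             (fun u => (1 - u ^ (2 * n)) / (1 - u ^ 2)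
                + (u ^ (2 * n) * / (1 - u ^ 2)
                   + mono u * (2 * u / (1 - u ^ 2) ^ 2))
                - / (1 - u ^ 2))); [lra | |]; intros u Hu.
    + apply (is_derive_minus (fun u => artanh_sum n u + mono u / (1 - u ^ 2)));
        [| apply is_derive_half_ln_ratio; lra].
      apply (is_derive_plus (artanh_sum n));
        [apply is_derive_artanh_sum; lra |].
      assert (0 < 1 - u ^ 2) by nra.
      apply (is_derive_mult mono (fun u => / (1 - u ^ 2)));
        [apply is_derive_odd_monomial | | intros; apply Rmult_comm].
      auto_derive; [lra | field; lra].
    + assert (0 < 1 - u ^ 2) by nra.
      assert (0 < mono u)
        by (apply Rdiv_lt_0_compat; [apply pow_lt; lra | exact Hn]).
      assert (0 < 2 * u / (1 - u ^ 2) ^ 2)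
        by (apply Rdiv_lt_0_compat; [lra | apply pow_lt; lra]).
      replace ((1 - u ^ (2 * n)) / (1 - u ^ 2))
        with (/ (1 - u ^ 2) - u ^ (2 * n) * / (1 - u ^ 2)) by (field; lra).
      nra.
Qed.

Lemma ln_series_bounds (n : nat) (x : R) : 1 < x ->
  let z := (x - 1) / (x + 1) in
  2 * artanh_sum n z < ln x
  < 2 * (artanh_sum n z + z ^ (2 * n + 1) / INR (2 * n + 1) / (1 - z ^ 2)).
Proof.
  intros Hx z.
  assert (Hz : 0 < z < 1).
  { unfold z. split; [apply Rdiv_lt_0_compat; lra | apply Rlt_div_l; lra]. }
  replace (ln x) with (2 * half_ln_ratio z).
  - pose proof (half_ln_ratio_bounds n z Hz). lra.
  - unfold half_ln_ratio. rewrite <- (ln_div (1 + z) (1 - z)) by lra.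
    replace ((1 + z) / (1 - z)) with x.
    + field.
    + assert (z * (x + 1) = x - 1) by (unfold z; field; lra).
      field_simplify_eq; lra.
Qed.

Lemma ln_le (x y : R) : 0 < x -> x <= y -> ln x <= ln y.
Proof.
  intros Hx [H | ->]; [left; apply ln_increasing; assumption | lra].
Qed.

Ltac ln_bound n x :=
  let H := fresh in
  pose proof (ln_series_bounds n x ltac:(lra)) as H;
  cbv zeta in H; cbn [artanh_sum] in H; rewrite !INR_IZR_INZ in H;
  cbn [Nat.mul Nat.add Z.of_nat Pos.of_succ_nat Pos.succ] in H; lra.

Lemma ln_2_bounds : 69314 / 100000 < ln 2 < 69315 / 100000.
Proof. split; ln_bound 5%nat 2. Qed.

Lemma tmax_bounds : 88137 / 100000 < tmax < 88138 / 100000.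
Proof.
  pose proof sqrt2_bounds. unfold tmax. split.
  - apply (Rlt_le_trans _ (ln (2414213 / 1000000))); [| apply ln_le; lra].
    ln_bound 6%nat (2414213 / 1000000).
  - apply (Rle_lt_trans _ (ln (2414214 / 1000000))); [apply ln_le; lra |].
    ln_bound 6%nat (2414214 / 1000000).
Qed.

Lemma beta7_bound_bounds : 3977 / 10000 <= beta7_bound < 3978 / 10000.
Proof.
  pose proof sqrt2_bounds. pose proof tmax_bounds. pose proof ln_2_bounds.
  (* Subtracting [ln 2] inside the logarithm gives an argument near [1.148],
     for which two terms of the series suffice. *)
  assert (Heq : beta7_bound = 2 * ln ((sqrt 2 + tmax) / 2) / ln 2).
  { unfold beta7_bound. fold tmax. rewrite ln_div by lra. field. lra. }
  assert (Hln : 137837 / 1000000 < ln ((sqrt 2 + tmax) / 2) < 137850 / 1000000).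
  { split.
    - apply (Rlt_le_trans _ (ln (114779 / 100000))); [| apply ln_le; lra].
      ln_bound 2%nat (114779 / 100000).
    - apply (Rle_lt_trans _ (ln (1147797 / 1000000))); [apply ln_le; lra |].
      ln_bound 2%nat (1147797 / 1000000). }
  rewrite Heq. split; [apply -> Rle_div_r | apply Rlt_div_l]; lra.
Qed.

Lemma alpha8_bound_bounds : 5603 / 10000 <= alpha8_bound < 5604 / 10000.
Proof.
  pose proof sqrt2_bounds. pose proof tmax_bounds.
  unfold alpha8_bound. fold tmax.
  split; [apply -> Rle_div_r | apply Rlt_div_l]; nra.
Qed.

(** * Best constants for the gaps *)

Lemma geo_gap_le (b1 b2 t : R) :
  0 < t -> b1 <= b2 <-> geo_gap b1 t <= geo_gap b2 t.
Proof.
  intros Ht. pose proof (ln_nu_bounds t Ht). unfold geo_gap. split; nra.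
Qed.

Lemma harm_gap_le (l1 l2 t : R) :
  0 < t -> l1 <= l2 <-> harm_gap l2 t <= harm_gap l1 t.
Proof.
  intros Ht. pose proof (cosh_gt_1 t Ht).
  assert (0 < / cosh t < 1).
  { split; [apply Rinv_0_lt_compat; lra |].
    rewrite <- Rinv_1. apply Rinv_lt_contravar; lra. }
  unfold harm_gap, Rdiv. split; nra.
Qed.

(** The capped parameters [Rmin a7 (1/2)] and [Rmax b8 0] bring a parameter
    assumed to violate its bound into the range where the sign near [0] is
    known, and monotonicity in the parameter transfers the conclusion back. *)
Lemma gaps_iff (a7 b7 a8 b8 : R) :
  (forall t, 0 < t < tmax ->
     geo_gap a7 t < 0 < geo_gap b7 t /\ harm_gap b8 t < 0 < harm_gap a8 t)
  <-> a7 <= 1 / 3 /\ beta7_bound <= b7 /\ a8 <= alpha8_bound /\ 2 / 3 <= b8.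
Proof.
  assert (Hbeta : 1 / 3 <= beta7_bound <= 1 / 2)
    by (pose proof beta7_bound_bounds; lra).
  assert (Halpha : 1 / 3 <= alpha8_bound)
    by (pose proof alpha8_bound_bounds; lra).
  pose proof tmax_pos as HT.
  assert (Hnear : forall f, pos_near_0 f -> exists t, 0 < f t /\ 0 < t < tmax).
  { intros f Hf. apply (filter_ex (F := at_right 0)).
    apply filter_and; [exact Hf | apply at_right_0_interval, HT]. }
  split.
  - intros H. repeat split.
    + apply Rnot_lt_le. intros Ha.
      destruct (Hnear (geo_gap (Rmin a7 (1 / 2)))) as (t & Hpos & Ht).
      { apply geo_gap_pos_near_0.
        split; [apply Rmin_glb_lt; lra | apply Rmin_r]. }
      specialize (H t Ht).
      pose proof (proj1 (geo_gap_le (Rmin a7 (1 / 2)) a7 t (proj1 Ht))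
                    (Rmin_l _ _)).
      lra.
    + apply (geo_gap_le _ _ tmax HT). rewrite geo_gap_tmax.
      apply nonneg_at_right_end;
        [exact HT | apply (continuous_gaps_tmax b7 0) |].
      intros t Ht. apply H, Ht.
    + apply (harm_gap_le _ _ tmax HT). rewrite harm_gap_tmax.
      apply nonneg_at_right_end;
        [exact HT | apply (continuous_gaps_tmax 0 a8) |].
      intros t Ht. apply H, Ht.
    + apply Rnot_lt_le. intros Hb.
      destruct (Hnear (harm_gap (Rmax b8 0))) as (t & Hpos & Ht).
      { apply harm_gap_pos_near_0.
        split; [apply Rmax_r | apply Rmax_lub_lt; lra]. }
      specialize (H t Ht).
      pose proof (proj1 (harm_gap_le b8 (Rmax b8 0) t (proj1 Ht)) (Rmax_l _ _)).
      lra.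
  - intros (Ha7 & Hb7 & Ha8 & Hb8) t Ht.
    pose proof (geo_gap_neg t (proj1 Ht)).
    pose proof (harm_gap_neg t (proj1 Ht)).
    pose proof (pos_before_zero _ _ t (geo_gap_descends _ Hbeta)
                  geo_gap_tmax Ht).
    pose proof (pos_before_zero _ _ t (harm_gap_descends _ Halpha)
                  harm_gap_tmax Ht).
    apply (geo_gap_le _ _ t (proj1 Ht)) in Ha7, Hb7.
    apply (harm_gap_le _ _ t (proj1 Ht)) in Ha8, Hb8. lra.
Qed.

(** * From means to the hyperbolic parameter *)

Lemma arcosh_cosh (t : R) : 0 < t -> arcosh (cosh t) = t.
Proof.
  intros Ht. hyperbolic_facts t Ht. unfold arcosh.
  replace (cosh t ^ 2 - 1) with (sinh t ^ 2) by lra.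
  rewrite sqrt_pow2 by lra.
  replace (cosh t + sinh t) with (exp t) by (unfold cosh, sinh; field).
  apply ln_exp.
Qed.

Lemma neuman_mean_cosh (A t : R) :
  0 < A -> 0 < t -> neuman_mean (A * cosh t) A = A * nu t.
Proof.
  intros HA Ht. hyperbolic_facts t Ht. unfold neuman_mean, SB.
  destruct (Rlt_dec (A * cosh t) A) as [Hlt | _]; [nra |].
  replace ((A * cosh t) ^ 2 - A ^ 2) with ((A * sinh t) ^ 2) by nra.
  rewrite sqrt_pow2 by nra.
  replace (A * cosh t / A) with (cosh t) by (field; lra).
  rewrite arcosh_cosh by exact Ht. unfold nu. field. lra.
Qed.

Lemma means_of_parameter (a b t : R) :
  0 < a -> 0 < b -> 0 < t -> sinh t = Rabs (a - b) / (a + b) ->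
  quad_mean a b = arith_mean a b * cosh t /\ N_QA a b = arith_mean a b * nu t.
Proof.
  intros Ha Hb Ht Hs. hyperbolic_facts t Ht.
  assert (HA : 0 < arith_mean a b) by (unfold arith_mean; lra).
  assert (HQ : quad_mean a b = arith_mean a b * cosh t).
  { unfold quad_mean, arith_mean. apply sqrt_lem_1; [nra | nra |].
    transitivity (((a + b) / 2) ^ 2 * cosh t ^ 2); [ring |].
    rewrite H, Hs. unfold Rdiv at 2. rewrite Rpow_mult_distr, pow2_abs.
    field. lra. }
  split; [exact HQ |]. unfold N_QA. rewrite HQ.
  apply neuman_mean_cosh; assumption.
Qed.

(** Divided by [N], the geometric combination is the exponential of a
    [geo_gap], to be compared with [1]; multiplied by [A], the difference
    between [1 / N] and the harmonic combination is a [harm_gap]. *)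
Lemma inequalities_iff_gaps (a b t a7 b7 a8 b8 : R) :
  0 < a -> 0 < b -> 0 < t -> sinh t = Rabs (a - b) / (a + b) ->
  ((Rpower (quad_mean a b) a7 * Rpower (arith_mean a b) (1 - a7)
      < N_QA a b
      < Rpower (quad_mean a b) b7 * Rpower (arith_mean a b) (1 - b7))
   /\ (a8 / arith_mean a b + (1 - a8) / quad_mean a b
         < 1 / N_QA a b
         < b8 / arith_mean a b + (1 - b8) / quad_mean a b))
  <-> (geo_gap a7 t < 0 < geo_gap b7 t /\ harm_gap b8 t < 0 < harm_gap a8 t).
Proof.
  intros Ha Hb Ht Hs.
  destruct (means_of_parameter a b t Ha Hb Ht Hs) as [-> ->].
  assert (HA : 0 < arith_mean a b) by (unfold arith_mean; lra).
  set (A := arith_mean a b) in *. clearbody A.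
  hyperbolic_facts t Ht. pose proof (nu_bounds t Ht) as Hnu.
  assert (Hgeo : forall e,
    Rpower (A * cosh t) e * Rpower A (1 - e)
    = A * nu t * exp (geo_gap e t)).
  { intros e. rewrite <- (exp_ln (A * nu t)) by nra.
    unfold Rpower, geo_gap. rewrite <- !exp_plus, !ln_mult by lra.
    f_equal. ring. }
  assert (Hharm : forall e,
    e / A + (1 - e) / (A * cosh t) = 1 / (A * nu t) - / A * harm_gap e t).
  { intros e. unfold harm_gap. field. lra. }
  rewrite !Hgeo, !Hharm.
  assert (HN : 0 < A * nu t) by nra. assert (HiA := Rinv_0_lt_compat A HA).
  assert (Hexp : forall x, (x < 0 <-> exp x < 1) /\ (0 < x <-> 1 < exp x)).
  { intros x. rewrite <- exp_0. split; split;
      auto using exp_increasing, exp_lt_inv. }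
  destruct (Hexp (geo_gap a7 t)) as [-> _].
  destruct (Hexp (geo_gap b7 t)) as [_ ->].
  split; intros [[H2 H3] [H4 H5]]; repeat split; nra.
Qed.

Lemma inequalities_iff_parameters (a7 b7 a8 b8 : R) :
  (forall a b : R, 0 < a -> 0 < b -> a <> b ->
    (Rpower (quad_mean a b) a7 * Rpower (arith_mean a b) (1 - a7)
       < N_QA a b
       < Rpower (quad_mean a b) b7 * Rpower (arith_mean a b) (1 - b7))
    /\ (a8 / arith_mean a b + (1 - a8) / quad_mean a b
          < 1 / N_QA a b
          < b8 / arith_mean a b + (1 - b8) / quad_mean a b))
  <-> (forall t, 0 < t < tmax ->
     geo_gap a7 t < 0 < geo_gap b7 t /\ harm_gap b8 t < 0 < harm_gap a8 t).
Proof.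
  destruct sinh_cosh_tmax as [HT _]. split.
  (* The pair [1 + sinh t], [1 - sinh t] has arithmetic mean [1] and realizes
     the parameter [t]; it is positive because [sinh t < sinh tmax = 1]. *)
  - intros H t Ht. pose proof (sinh_pos t (proj1 Ht)).
    pose proof (sinh_increasing t tmax (proj2 Ht)).
    apply (inequalities_iff_gaps (1 + sinh t) (1 - sinh t) t); try lra.
    + rewrite Rabs_pos_eq by lra. field. lra.
    + apply H; lra.
  - intros H a b Ha Hb Hab.
    set (x := Rabs (a - b) / (a + b)).
    assert (Hx : 0 < x < 1).
    { assert (0 < Rabs (a - b) < a + b).
      { split; [apply Rabs_pos_lt; lra | apply Rabs_def1; lra]. }
      split; [apply Rdiv_lt_0_compat; lra | apply Rlt_div_l; lra]. }
    assert (Ht : 0 < arcsinh x < tmax).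
    { split; apply sinh_lt_inv; rewrite sinh_arcsinh; rewrite ?sinh_0; lra. }
    apply (inequalities_iff_gaps a b (arcsinh x)); auto; [lra |].
    apply sinh_arcsinh.
Qed.

(** * The sharp bounds *)

Theorem theorem3p4 (alpha7 beta7 alpha8 beta8 : R) :
  ((forall a b : R, 0 < a -> 0 < b -> a <> b ->
      (Rpower (quad_mean a b) alpha7 * Rpower (arith_mean a b) (1 - alpha7)
         < N_QA a b
         < Rpower (quad_mean a b) beta7 * Rpower (arith_mean a b) (1 - beta7))
      /\
      (alpha8 / arith_mean a b + (1 - alpha8) / quad_mean a b
         < 1 / N_QA a b
         < beta8 / arith_mean a b + (1 - beta8) / quad_mean a b))
   <->
   (alpha7 <= 1 / 3 /\ beta7 >= beta7_bound /\
    alpha8 <= alpha8_bound /\ beta8 >= 2 / 3))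
  /\ 3977 / 10000 <= beta7_bound < 3978 / 10000
  /\ 5603 / 10000 <= alpha8_bound < 5604 / 10000.
Proof.
  pose proof beta7_bound_bounds as Hb. pose proof alpha8_bound_bounds as Ha.
  split; [| split; assumption].
  rewrite inequalities_iff_parameters, gaps_iff.
  split; intros (H1 & H2 & H3 & H4); repeat split; lra.
Qed.
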